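(* Let $G$ be a finite simple graph. If $E(G)$ can be decomposed into cliques of odd order (that is, $E(G)$ can be partitioned into the edge sets of complete subgraphs of $G$, each having an odd number of vertices), then $G$ is total weight $(1,3)$-choosable.
   Context: For a finite simple graph $G=(V,E)$ and a vertex $i\in V$, let $E(i)$ denote the set of edges incident to $i$. A total weighting of $G$ is a mapping $\phi: V\cup E\to\mathbb{R}$; it is proper if for every edge $\{i,j\}\in E$, $\sum_{e\in E(i)}\phi(e)+\phi(i)\neq \sum_{e\in E(j)}\phi(e)+\phi(j)$. For positive integers $k,k'$, $G$ is total weight $(k,k')$-choosable if for every assignment $L$ of a set $L(v)$ of $k$ real numbers to each vertex $v\in V$ and a set $L(e)$ of $k'$ real numbers to each edge $e\in E$, there is a proper total weighting $\phi$ of $G$ with $\phi(z)\in L(z)$ for all $z\in V\cup E$. The complete subgraphs in a decomposition may have different (odd) orders. *)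

(* Defs.v *)
From mathcomp Require Import all_boot all_order all_algebra finmap reals.

Set Implicit Arguments.
Unset Strict Implicit.
Unset Printing Implicit Defensive.

Import Order.TTheory GRing.Theory Num.Theory.

Local Open Scope ring_scope.

Record sgraph := SGraph {
  vertex :> finType;
  adj : rel vertex;
  adj_sym : symmetric adj;
  adj_irrefl : irreflexive adj }.

Definition edges (G : sgraph) : {set {set G}} :=
  [set [set x; y] | x in [set: G], y in [set: G] & adj x y].

Definition edge (G : sgraph) : finType := {A : {set G} | A \in edges G}.

Definition clique (G : sgraph) (K : {set G}) : Prop :=
  {in K &, forall x y, x != y -> adj x y}.

(* When K is a clique, this is the edge set of the complete subgraph on K. *)
Definition edges_in (G : sgraph) (K : {set G}) : {set {set G}} :=
  [set A in edges G | A \subset K].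

Definition odd_clique_decomposable (G : sgraph) : Prop :=
  exists P : {set {set {set G}}},
    partition P (edges G) /\
    forall B, B \in P ->
      exists K : {set G}, [/\ clique K, odd #|K| & B = edges_in K].

Section TotalWeighting.
Variables (R : realType) (G : sgraph).

(* The disjoint sum G + edge G stands for the union of V and E. *)
Definition vertex_sum (phi : G + edge G -> R) (i : G) : R :=
  \sum_(e : edge G | i \in val e) phi (inr e) + phi (inl i).

Definition proper_weighting (phi : G + edge G -> R) : Prop :=
  forall i j : G, adj i j -> vertex_sum phi i <> vertex_sum phi j.

Definition total_weight_choosable (k k' : nat) : Prop :=
  forall L : G + edge G -> {fset R},
    (forall v : G, #|` L (inl v)| = k) ->
    (forall e : edge G, #|` L (inr e)| = k') ->
    exists phi : G + edge G -> R,
      proper_weighting phi /\ forall z, phi z \in L z.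

End TotalWeighting.

(* Main.v *)
(** Let C be the signed and B the unsigned vertex-edge incidence matrix (rows
    indexed by edges). With the vertex weights fixed, the differences to be made
    nonzero are affine forms in the edge weights with linear part C B^T. By the
    Combinatorial Nullstellensatz it suffices to find a choice h of columns,
    each used at most twice, such that the matrix with columns (C B^T)_{h(r)}
    has nonzero permanent. In a clique of odd order n, identify the vertices
    with Z_n and let z = (x + y)/2 be the midpoint of r = {x, y}; then
    C_r = B_{xz} - B_{yz}, and every edge occurs at most twice among the xz and
    yz. Expanding along this identity, per(C C^T) is a signed sum of permanents
    of admissible column choices. Finally, per(C C^T) is a sum of squares up to
    a factor, and is positive because prod_r (x_u - x_v) is a nonzero
    polynomial. *)

Require Import Defs.
From mathcomp Require Import all_boot all_order all_algebra finmap reals.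
From mathcomp Require Import fingroup perm.

Set Implicit Arguments.
Unset Strict Implicit.
Unset Printing Implicit Defensive.

Import Order.TTheory GRing.Theory Num.Theory.

Local Open Scope ring_scope.

(** * Coefficient extraction and a permanent form of the Combinatorial Nullstellensatz *)

Lemma big_option (T : Type) (idx : T) (op : Monoid.com_law idx) (J : finType)
    (F : option J -> T) :
  \big[op/idx]_o F o = op (F None) (\big[op/idx]_j F (Some j)).
Proof.
rewrite (bigD1 None) //=; congr (op _ _).
rewrite (reindex_omap Some id) /=; last by case.
by apply: eq_bigl => j; rewrite eqxx.
Qed.

(** The Vandermonde matrix of distinct nodes is invertible. A column of its inverse is a functional
    on the values at the nodes that reads off the coefficient of X^k from any polynomial of degree
    below n. *)
Lemma dual_weights (F : fieldType) (n k : nat) (a : 'I_n -> F) :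
  injective a -> (k < n)%N ->
  exists w : 'I_n -> F, forall d, (d < n)%N ->
    \sum_l w l * a l ^+ d = (d == k)%:R.
Proof.
move=> a_inj lt_kn.
pose V := Vandermonde n (\row_l a l).
have V_unit : V \in unitmx.
  rewrite unitmxE det_Vandermonde unitfE.
  apply/prodf_neq0 => i _; apply/prodf_neq0 => j lt_ij.
  rewrite !mxE subr_eq0; apply: contraTneq lt_ij => /a_inj ->.
  by rewrite ltnn.
exists (fun l => (invmx V *m delta_mx (Ordinal lt_kn) (0 : 'I_1)) l 0) => d lt_dn.
have /matrixP/(_ (Ordinal lt_dn) 0) := mulKVmx V_unit (delta_mx (Ordinal lt_kn) (0 : 'I_1)).
rewrite [LHS]mxE !mxE eqxx andbT -val_eqE /= => <-.
set W := invmx V *m _; apply: eq_bigr => l _.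
have -> : V (Ordinal lt_dn) l = a l ^+ d by rewrite !mxE.
exact: mulrC.
Qed.

Section PermanentNullstellensatz.
Variables (F : fieldType) (m : nat) (J : finType).

Definition mult (T : eqType) (g : 'I_m -> T) (x : T) : nat := \sum_i (g i == x).

Lemma sum_mult (T : finType) (g : 'I_m -> T) : (\sum_x mult g x)%N = m.
Proof.
rewrite exchange_big /= (eq_bigr (fun=> 1%N)) ?sum_nat_const ?card_ord ?muln1 //.
move=> i _; rewrite (bigD1 (g i)) //= eqxx big1 ?addn0 // => x.
by rewrite eq_sym => /negbTE ->.
Qed.

Lemma count_mem_mult (T : eqType) (g : 'I_m -> T) (x : T) :
  count_mem x [tuple g i | i < m] = mult g x.
Proof.
rewrite /mult -sum1_count big_map big_mkcond /= big_enum /=.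
by apply: eq_bigr => i _; case: eqP.
Qed.

Lemma eq_mult_perm (T : eqType) (g h : 'I_m -> T) :
  mult g =1 mult h -> exists s : 'S_m, forall i, g i = h (s i).
Proof.
move=> gh.
have /tuple_permP [s Es] : perm_eq [tuple g i | i < m] [tuple h i | i < m].
  by apply/allP => x _ /=; rewrite !count_mem_mult gh.
exists s => i.
have := congr1 (fun u => nth (g i) u i) Es.
by rewrite -!tnth_nth !tnth_mktuple.
Qed.

Lemma mult_perm (T : eqType) (h : 'I_m -> T) (s : 'S_m) :
  mult (fun i => h (s i)) =1 mult h.
Proof. by move=> x; rewrite /mult [RHS](reindex_inj (@perm_inj _ s)). Qed.

(* Each rearrangement of [h] arises from equally many permutations. *)
Lemma sum_perm_comp (T : finType) (h : 'I_m -> T) (X : {ffun 'I_m -> T} -> F) :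
  \sum_(s : 'S_m) X [ffun i => h (s i)] =
  (\sum_(g : {ffun 'I_m -> T} | [forall x, mult g x == mult h x]) X g)
    *+ #|[set s : 'S_m | [forall i, h (s i) == h i]]|.
Proof.
rewrite (partition_big (fun s : 'S_m => [ffun i => h (s i)])
   (fun g => [forall x, mult g x == mult h x])) /=; last first.
  move=> s _; apply/forallP => x; apply/eqP; rewrite -(mult_perm h s x).
  by apply: eq_bigr => i _; rewrite ffunE.
rewrite -sumrMnl; apply: eq_bigr => g /forallP gh.
have [|s0 Es0] := @eq_mult_perm _ g h; first by move=> x; apply/eqP.
rewrite (eq_bigr (fun=> X g)) => [|s /eqP-> //].
rewrite sumr_const; congr (_ *+ _).
(* The fibre over [g] is the coset by [s0] of the stabilizer of [h]. *)
rewrite -[RHS](card_imset _ (mulgI s0)); apply: eq_card => s.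
transitivity ([ffun i => h (s i)] == g) => //.
apply/eqP/imsetP => [Es | [t + ->]].
  exists (s0^-1 * s)%g; last by rewrite mulKVg.
  rewrite inE; apply/forallP => i; apply/eqP.
  have := Es0 (s0^-1%g i); rewrite -Es ffunE permKV => <-.
  by rewrite permM.
rewrite inE => /forallP ht; apply/ffunP => i.
by rewrite ffunE permM (eqP (ht _)) -Es0.
Qed.

(* On [n] points per variable, the tensor product of [dual_weights] extracts the
   coefficient of the monomial prod_i x_(h i) from the product of the forms,
   because that monomial has top degree. *)
Lemma permanent_nullstellensatz (n : nat) (A : 'I_m -> J -> F) (c : 'I_m -> F)
    (a : J -> 'I_n -> F) (h : 'I_m -> J) :
  (forall j, injective (a j)) -> (forall j, mult h j < n)%N ->
  \sum_(s : 'S_m) \prod_i A (s i) (h i) != 0 ->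
  exists f : J -> 'I_n, forall i, \sum_j A i j * a j (f j) + c i != 0.
Proof.
move=> a_inj h_lt per_neq0.
have /fin_all_exists [w wE] := fun j => dual_weights (a_inj j) (h_lt j).
(* The constant [c i] becomes the coefficient of an extra variable [None] evaluated at 1, which
   makes the forms homogeneous. *)
pose B i o := if o is Some j then A i j else c i.
pose H i := Some (h i).
have multH j : mult H (Some j) = mult h j by [].
have multHN : mult H None = 0%N by rewrite /mult big1.
pose S := \sum_(f : {ffun J -> 'I_n})
  (\prod_j w j (f j)) * \prod_i (\sum_j A i j * a j (f j) + c i).
have SE : S = \sum_(g : {ffun 'I_m -> option J} | [forall o, mult g o == mult H o])
                 \prod_i B i (g i).
  pose mom j d := \sum_l w j l * a j l ^+ d.
  have -> : S = \sum_(g : {ffun 'I_m -> option J})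
      (\prod_i B i (g i)) * \prod_j mom j (mult g (Some j)).
    rewrite /S; under eq_bigr => f _.
      have -> : \prod_i (\sum_j A i j * a j (f j) + c i) =
        \sum_(g : {ffun 'I_m -> option J}) (\prod_i B i (g i)) *
          \prod_j a j (f j) ^+ mult g (Some j).
        pose X o := \prod_j a j (f j) ^+ (o == Some j).
        have XS j : X (Some j) = a j (f j).
          rewrite /X (bigD1 j) //= eqxx expr1 big1 ?mulr1 // => k kj.
          by rewrite (inj_eq (@Some_inj _)) eq_sym (negbTE kj).
        have XN : X None = 1 by rewrite /X big1.
        under eq_bigr => i _.
          have -> : \sum_j A i j * a j (f j) + c i = \sum_o B i o * X o.
            rewrite big_option /= XN mulr1 addrC; congr (_ + _).
            by apply: eq_bigr => j _; rewrite XS.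
          over.
        rewrite bigA_distr_bigA /=; apply: eq_bigr => g _.
        rewrite big_split /=; congr (_ * _).
        by rewrite exchange_big /=; apply: eq_bigr => j _; rewrite prodrXr.
      rewrite big_distrr /=.
      over.
    rewrite exchange_big /=; apply: eq_bigr => g _.
    rewrite bigA_distr_bigA big_distrr /=; apply: eq_bigr => f _.
    by rewrite mulrCA big_split.
  rewrite [RHS]big_mkcond; apply: eq_bigr => g _.
  case: ifPn => [/forallP gH | gH].
    rewrite [X in _ * X]big1 ?mulr1 // => j _.
    by rewrite (eqP (gH _)) /mom wE ?h_lt // eqxx.
  (* Both families of multiplicities add up to m, so if no variable had a smaller exponent in [g]
     than in [h], the two would agree and [None] would not occur. At a smaller exponent the moment
     vanishes. *)
  suff /existsP [j lt_j] : [exists j, mult g (Some j) < mult h j]%N.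
    rewrite (bigD1 j) //= {1}/mom wE ?(ltn_trans lt_j) //.
    by rewrite ltn_eqF // mul0r mulr0.
  apply: contraR gH => /existsPn ge.
  have le_j j : (mult h j <= mult g (Some j) ?= iff (mult h j == mult g (Some j)))%N.
    by split=> //; rewrite leqNgt.
  have := sum_mult g; rewrite big_option /= => Eg.
  have := sum_mult h => Eh.
  have [le_s eq_s] := leqif_sum (fun j (_ : true) => le_j j).
  have EgN : mult g None = 0%N.
    apply/eqP; rewrite -leqn0 -(leq_add2r (\sum_j mult g (Some j))) Eg add0n.
    by rewrite -[leqLHS]Eh.
  move: eq_s; rewrite Eh -[X in X == _]Eg EgN add0n eqxx => /esym/forallP eqh.
  by apply/forallP => -[j|]; rewrite ?multHN ?EgN // eq_sym; apply: eqh.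
have S_neq0 : S != 0.
  apply: contraNneq per_neq0 => S0.
  (* Inverting s moves the permutation from the rows of [A] to [h]; the permanent is then a multiple
     of [S]. *)
  rewrite (reindex_inj invg_inj) /=.
  rewrite (eq_bigr (fun s : 'S_m => (fun g : {ffun _} => \prod_i B i (g i))
     [ffun i => H (s i)])) => [|s _].
    by rewrite (sum_perm_comp H (fun g => \prod_i B i (g i))) -SE S0 mul0rn.
  rewrite (reindex_inj (@perm_inj _ s)); apply: eq_bigr => i _.
  by rewrite ffunE permK.
have [f /prodf_neq0 fP|all0] := pickP (fun f : {ffun J -> 'I_n} =>
    \prod_i (\sum_j A i j * a j (f j) + c i) != 0).
  by exists f => i; apply: fP.
by case/eqP: S_neq0; apply: big1 => f _; move/negbFE/eqP: (all0 f) => ->; rewrite mulr0.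
Qed.

End PermanentNullstellensatz.

(** * Positivity of the permanent of a Gram matrix *)

(* With p w the coefficient of prod_i x_(w i), up to symmetrization, in the
   product of the linear forms C i, the permanent of the Gram matrix is
   (sum_w p(w)^2) / m!; if all p w vanish, so does the product of the forms. *)
Lemma gram_permanent_gt0 (R : realFieldType) (m : nat) (V : finType)
    (C : 'I_m -> V -> R) (x : V -> R) :
  (forall i, \sum_v C i v * x v != 0) ->
  0 < \sum_(s : 'S_m) \prod_i \sum_v C (s i) v * C i v.
Proof.
move=> Cx_neq0.
pose p (w : {ffun 'I_m -> V}) := \sum_(s : 'S_m) \prod_i C (s i) (w i).
have pE (w : {ffun 'I_m -> V}) (t : 'S_m) : p [ffun i => w (t i)] = p w.
  rewrite /p (reindex_inj (mulgI t)) /=; apply: eq_bigr => s _.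
  rewrite [RHS](reindex_inj (@perm_inj _ t)) /=; apply: eq_bigr => i _.
  by rewrite ffunE permM.
have perE : \sum_(s : 'S_m) \prod_i \sum_v C (s i) v * C i v =
    \sum_w p w * \prod_i C i (w i).
  under eq_bigr do rewrite bigA_distr_bigA /=.
  rewrite exchange_big; apply: eq_bigr => w _ /=.
  by rewrite mulr_suml; apply: eq_bigr => s _; rewrite big_split.
have perM : (\sum_(s : 'S_m) \prod_i \sum_v C (s i) v * C i v) *+ #|{: 'S_m}| =
    \sum_w p w ^+ 2.
  (* Copy t of the sum is reindexed by t. As [p] is symmetric, only the product changes, and summing
     it over t gives [p w] again. *)
  rewrite perE -sumr_const.
  rewrite (eq_bigr (fun t : 'S_m => \sum_w p w * \prod_i C (t i) (w i))); last first.
    move=> t _.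
    have inj_t : injective (fun w : {ffun 'I_m -> V} => [ffun i => w (t i)]).
      move=> w w' /ffunP E; apply/ffunP => i.
      by have := E (t^-1%g i); rewrite !ffunE permKV.
    rewrite [RHS](reindex_inj inj_t) /=; apply: eq_bigr => w _; rewrite pE.
    congr (_ * _); rewrite (reindex_inj (@perm_inj _ t)); apply: eq_bigr => i _.
    by rewrite ffunE.
  rewrite exchange_big /=; apply: eq_bigr => w _.
  by rewrite -mulr_sumr expr2.
have sm_gt0 : (0 < #|{: 'S_m}|)%N by apply/card_gt0P; exists 1%g.
rewrite -(pmulrn_lgt0 _ sm_gt0) perM lt_neqAle sumr_ge0 ?andbT; last first.
  by move=> w _; apply: sqr_ge0.
rewrite eq_sym; apply/negP => /eqP sum0.
have p0 w : p w = 0.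
  have /(_ w isT)/eqP := psumr_eq0P (fun w (_ : true) => sqr_ge0 (p w)) sum0.
  by rewrite sqrf_eq0 => /eqP.
have : \sum_w p w * \prod_i x (w i) = (\prod_i \sum_v C i v * x v) *+ #|{: 'S_m}|.
  rewrite -sumr_const.
  rewrite (eq_bigr (fun t : 'S_m => \sum_(w : {ffun 'I_m -> V}) \prod_i (C (t i) (w i) * x (w i)))).
    rewrite exchange_big; apply: eq_bigr => w _ /=; rewrite mulr_suml.
    by apply: eq_bigr => t _; rewrite big_split.
  move=> t _; rewrite (reindex_inj (@perm_inj _ t)) /=.
  by rewrite bigA_distr_bigA.
rewrite big1 => [/esym/eqP|w _]; last by rewrite p0 mul0r.
rewrite mulrn_eq0 (gtn_eqF sm_gt0) /=; apply/negP.
by apply/prodf_neq0 => i _.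
Qed.

(** * Midpoints in cliques of odd order *)

Lemma midpoint_exists (T : finType) (K : {set T}) : odd #|K| ->
  exists mid : T -> T -> T,
    [/\ {in K &, forall x y, mid x y \in K},
        forall x y, mid x y = mid y x,
        {in K, forall x, mid x x = x} &
        {in K & &, forall x y z, mid x y = mid x z -> y = z}].
Proof.
move=> oddK; have K_gt0 : (0 < #|K|)%N by case: #|K| oddK.
have /card_gt0P [x0 _] := K_gt0.
(* [q] is the inverse of 2 modulo the odd number [#|K|]. Doubling undoes it, which gives both
   idempotence and injectivity of [mid]. *)
pose q := #|K|./2.+1; pose idx x := index x (enum K).
have double_q i : (2 * (i * q) = i %[mod #|K|])%N.
  have q2 : (2 * q)%N = #|K|.+1.
    by rewrite -[in RHS](odd_double_half #|K|) oddK mul2n doubleS.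
  by rewrite mulnCA q2 mulnS addnC modnMDl.
have idx_lt x : x \in K -> (idx x < #|K|)%N.
  by move=> xK; rewrite cardE index_mem mem_enum.
have nth_idx x : x \in K -> nth x0 (enum K) (idx x) = x.
  by move=> xK; rewrite nth_index ?mem_enum.
pose mid x y := nth x0 (enum K) (((idx x + idx y) * q) %% #|K|).
exists mid; split=> [x y _ _ | x y | x xK | x y z xK yK zK].
- by rewrite -mem_enum mem_nth // -cardE ltn_mod.
- by rewrite /mid addnC.
- by rewrite /mid addnn -mul2n -mulnA double_q modn_small ?idx_lt ?nth_idx.
move/eqP; rewrite nth_uniq ?enum_uniq -?cardE ?ltn_mod // => /eqP E.
have : (2 * ((idx x + idx y) * q) = 2 * ((idx x + idx z) * q) %[mod #|K|])%N.
  by rewrite -modnMmr E modnMmr.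
rewrite !double_q => /eqP; rewrite eqn_modDl !modn_small ?idx_lt // => /eqP Eyz.
by rewrite -(nth_idx y) // Eyz nth_idx.
Qed.

Lemma mem_edges (G : sgraph) (x y : G) : ([set x; y] \in edges G) = adj x y.
Proof.
apply/imset2P/idP => [[a b _ + /setP E] | xy]; last by exists x y; rewrite ?inE.
rewrite !inE => /= ab; have ba := ab; rewrite adj_sym in ba.
have nab : a != b by apply: contraTneq ab => ->; rewrite adj_irrefl.
have:= E a; have := E b; have := E x; have := E y; rewrite !inE !eqxx ?orbT /=.
move=> /esym/orP [/eqP->|/eqP->] /esym/orP[/eqP->|/eqP->] //; rewrite ?orbb.
  by rewrite eq_sym (negbTE nab).
by rewrite (negbTE nab).
Qed.

(** Midpoints are taken inside the clique containing the edge xy. The edge from x to the midpoint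
    lies in that same clique, so x and the midpoint determine the clique, and injectivity reduces to
    a single clique. *)
Lemma odd_clique_midpoint (G : sgraph) : odd_clique_decomposable G ->
  exists mid : G -> G -> G,
    [/\ forall x y, adj x y -> mid x y = mid y x,
        forall x y, adj x y -> adj x (mid x y) &
        forall x y z, adj x y -> adj x z -> mid x y = mid x z -> y = z].
Proof.
case=> P [/and3P [/eqP coverP trivP _] cliqueP].
have /fin_all_exists [K KP] : forall B, exists K : {set G}, B \in P ->
    [/\ clique K, odd #|K| & B = edges_in K].
  move=> B; have [BP|_] := boolP (B \in P); last by exists set0.
  by have [K ?] := cliqueP B BP; exists K.
have /fin_all_exists [midB midBP] : forall B, exists mid : G -> G -> G, B \in P ->
    [/\ {in K B &, forall x y, mid x y \in K B},
        forall x y, mid x y = mid y x,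
        {in K B, forall x, mid x x = x} &
        {in K B & &, forall x y z, mid x y = mid x z -> y = z}].
  move=> B; have [BP|_] := boolP (B \in P); last by exists (fun x _ => x).
  have [_ oddK _] := KP B BP.
  by have [mid midP] := midpoint_exists oddK; exists mid.
pose block x y := pblock P [set x; y].
pose mid x y := midB (block x y) x y.
have blockC x y : block x y = block y x by rewrite /block setUC.
have blockP x y : adj x y -> [/\ block x y \in P, x \in K (block x y) &
    y \in K (block x y)].
  rewrite -mem_edges -coverP => xyP; have BP := pblock_mem xyP.
  have [_ _ E] := KP _ BP.
  have : [set x; y] \in pblock P [set x; y] by rewrite mem_pblock.
  by rewrite E inE => /andP[_]; rewrite subUset !sub1set => /andP[].
have midP x y : adj x y -> adj x (mid x y) /\ block x (mid x y) = block x y.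
  move=> xy; have [BP xK yK] := blockP x y xy.
  have [cK _ BE] := KP _ BP; have [mK _ mxx minj] := midBP _ BP.
  have zK : mid x y \in K (block x y) by apply: mK.
  have xz : adj x (mid x y).
    apply: cK => //; apply: contraTneq xy => xz.
    by rewrite -(minj x x y) ?adj_irrefl // mxx.
  split => //; apply: def_pblock => //; rewrite BE inE mem_edges xz /=.
  by rewrite subUset !sub1set xK.
exists mid; split=> [x y xy | x y /midP[] // | x y z xy xz E].
  have [BP _ _] := blockP x y xy.
  by rewrite /mid (blockC y) //; have [_ -> _ _] := midBP _ BP.
have Eb : block x y = block x z.
  by have [_ <-] := midP x y xy; have [_ <-] := midP x z xz; rewrite E.
have [BP xK yK] := blockP x y xy; have [_ _ zK] := blockP x z xz.
have [_ _ _] := midBP _ BP; apply; first exact: xK.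
- exact: yK.
- by rewrite Eb.
- by move: E; rewrite /mid -Eb.
Qed.

(* For an edge {x, y} with midpoint z, put e(x) = {x, z} and e(y) = {y, z}: an
   edge {a, b} can only be chosen once with midpoint a and once with midpoint
   b. *)
Lemma split_edges (G : sgraph) : odd_clique_decomposable G ->
  exists (u : edge G -> bool -> G) (e : edge G -> bool -> edge G),
    [/\ forall r, u r true != u r false,
        forall r, val r = [set u r true; u r false],
        forall r, exists z, forall b, u r b != z /\ val (e r b) = [set u r b; z] &
        forall (c : edge G -> bool) d, (#|[set r | e r (c r) == d]| <= 2)%N].
Proof.
case/odd_clique_midpoint => mid [midC mid_adj mid_inj].
have /fin_all_exists [p pP] : forall r : edge G, exists p : G * G,
    adj p.1 p.2 /\ val r = [set p.1; p.2].
  by move=> [A /= /imset2P [x y _]]; rewrite !inE /= => xy ->; exists (x, y).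
pose u r b := if b then (p r).1 else (p r).2.
pose z r := mid (p r).1 (p r).2.
have u_adj r b : adj (u r b) (u r (~~ b)).
  by have [xy _] := pP r; case: b => //=; rewrite adj_sym.
have zE r b : z r = mid (u r b) (u r (~~ b)).
  by case: b; rewrite //= /z midC //; have [] := pP r.
have uz r b : adj (u r b) (z r) by rewrite (zE r b); apply: mid_adj.
have rE r b : val r = [set u r b; u r (~~ b)].
  by have [_ ->] := pP r; case: b => //=; rewrite setUC.
have /fin_all_exists [e eP] : forall rb : edge G * bool, exists d : edge G,
    val d = [set u rb.1 rb.2; z rb.1].
  move=> [r b] /=; have ed : [set u r b; z r] \in edges G by rewrite mem_edges.
  by exists (exist (fun A => A \in edges G) _ ed).
have neq (x y : G) : adj x y -> x != y by apply: contraTneq => ->; rewrite adj_irrefl.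
exists u, (fun r b => e (r, b)); split=> [r | r | r | c d].
- by apply: neq; apply: (u_adj r true).
- exact: (rE r true).
- by exists (z r) => b; split; [apply: neq | rewrite eP].
(* Two edges that choose [d] with the same midpoint also share the other end of [d]; injectivity of
   [mid] at that end identifies them. *)
have z_inj : {in [set r | e (r, c r) == d] &, injective z}.
  move=> r r'; rewrite !inE => /eqP Er /eqP Er' zz.
  have E : [set u r (c r); z r] = [set u r' (c r'); z r].
    by rewrite {2}zz -(eP (r, c r)) -(eP (r', c r')) Er Er'.
  have Eu : u r (c r) = u r' (c r').
    have : u r (c r) \in [set u r' (c r'); z r] by rewrite -E !inE eqxx.
    by rewrite !inE (negbTE (neq _ _ (uz r (c r)))) orbF => /eqP.
  apply: val_inj; rewrite (rE r (c r)) (rE r' (c r')) -Eu; congr [set _; _].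
  apply: (mid_inj (u r (c r))); first exact: u_adj.
    by rewrite Eu; apply: u_adj.
  by rewrite -zE zz (zE r' (c r')) Eu.
rewrite -(card_in_imset z_inj) (@leq_trans #|val d|) //; last first.
  by rewrite (rE d true) cards2; case: eqP.
apply/subset_leq_card/subsetP => _ /imsetP [r + ->].
by rewrite inE => /eqP <-; rewrite eP !inE eqxx orbT.
Qed.

(** * From a nonzero permanent to a proper weighting *)

Lemma sum_incidence (R : pzRingType) (V : finType) (a b : V) (F : V -> R) :
  \sum_v ((v == a)%:R - (v == b)%:R) * F v = F a - F b.
Proof.
under eq_bigr do rewrite mulrBl !mulr_natl !mulrb.
by rewrite sumrB -!big_mkcond !big_pred1_eq.
Qed.

Theorem theorem1p1 (R : realType) (G : sgraph) :
  odd_clique_decomposable G -> total_weight_choosable R G 1 3.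
Proof.
case/split_edges => u [e [u_neq rE eP e_le2]] L L1 L3.
pose a (d : edge G) (l : 'I_3) : R := nth 0 (L (inr d)) l.
have a_inj d : injective (a d).
  move=> k l /eqP; rewrite nth_uniq ?fset_uniq ?L3 ?ltn_ord //.
  by move=> /eqP/val_inj.
pose phi0 v : R := nth 0 (L (inl v)) 0.
pose r (i : 'I_#|edge G|) : edge G := enum_val i.
(* [A i d] is the coefficient of the weight of [d] in the difference of the vertex sums at the ends
   of [r i]; [c i] is the constant part. *)
pose A i (d : edge G) : R :=
  (u (r i) true \in val d)%:R - (u (r i) false \in val d)%:R.
pose c i := phi0 (u (r i) true) - phi0 (u (r i) false).
pose h (b : {ffun 'I_#|edge G| -> bool}) i := e (r i) (b i).
have h_lt b d : (mult (h b) d < 3)%N.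
  rewrite ltnS (leq_trans _ (e_le2 (b \o enum_rank) d)) // /mult -sum1_card.
  rewrite [leqRHS]big_mkcond [leqRHS](reindex_onto r enum_rank) /=; last first.
    by move=> s _; rewrite /r enum_rankK.
  rewrite [leqRHS](eq_bigl predT) => [|i]; last by rewrite /r enum_valK eqxx.
  by apply: leq_sum => i _; rewrite inE /r enum_valK; case: eqP.
pose C i v : R := (v == u (r i) true)%:R - (v == u (r i) false)%:R.
(* The vertex ranks form a point where no row of [C] vanishes, since the ends of an edge have
   distinct ranks. *)
have C_rank i : \sum_v C i v * (enum_rank v)%:R != 0.
  rewrite sum_incidence subr_eq0 eqr_nat; apply: contraNneq (u_neq (r i)).
  by move=> /val_inj/enum_rank_inj ->.
(* The common end z of the two candidate edges cancels, leaving the ends of [r i]. *)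
have CE i v : C i v = (v \in val (e (r i) true))%:R - (v \in val (e (r i) false))%:R.
  have [z zP] := eP (r i); have [uzt ->] := zP true; have [uzf ->] := zP false.
  rewrite /C !inE; have [->|vz] := eqVneq v z; last by rewrite !orbF.
  by rewrite !orbT ![z == _]eq_sym (negbTE uzt) (negbTE uzf) !subrr.
(* Substituting [CE] in the second factor turns each Gram entry into a difference of two entries of
   [A]; expanding the product over i gives one signed permanent per choice [b]. *)
have gramE : \sum_(s : 'S_#|edge G|) \prod_i \sum_v C (s i) v * C i v =
    \sum_(b : {ffun 'I_#|edge G| -> bool}) (\prod_i (-1) ^+ (~~ b i)) *
      \sum_(s : 'S_#|edge G|) \prod_i A (s i) (h b i).
  under [RHS]eq_bigr do rewrite big_distrr /=.
  rewrite [RHS]exchange_big; apply: eq_bigr => s _ /=.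
  rewrite (eq_bigr (fun i => \sum_(t : bool) (-1) ^+ (~~ t) * A (s i) (e (r i) t))).
    by rewrite bigA_distr_bigA; apply: eq_bigr => b _; rewrite big_split.
  move=> i _; rewrite big_bool /= mul1r mulN1r.
  rewrite (eq_bigr _ (fun v _ => congr1 (fun y => C (s i) v * y) (CE i v))).
  by under eq_bigr do rewrite mulrBr; rewrite sumrB !sum_incidence.
have [b per_neq0] : exists b, \sum_(s : 'S_#|edge G|) \prod_i A (s i) (h b i) != 0.
  have := gram_permanent_gt0 C_rank; rewrite gramE.
  have [b b_neq0 | all0] := pickP (fun b =>
      \sum_(s : 'S_#|edge G|) \prod_i A (s i) (h b i) != 0); first by exists b.
  rewrite big1 ?ltxx // => b _.
  by move/negbFE/eqP: (all0 b) => ->; rewrite mulr0.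
have [f fP] := permanent_nullstellensatz c a_inj (h_lt b) per_neq0.
pose phi z := match z with inl v => phi0 v | inr d => a d (f d) end.
have sum_phi v : vertex_sum phi v = \sum_(d : edge G) (v \in val d)%:R * a d (f d) + phi0 v.
  rewrite /vertex_sum big_mkcond; congr (_ + _); apply: eq_bigr => d _.
  by rewrite mulr_natl mulrb.
have phi_edge d : vertex_sum phi (u d true) != vertex_sum phi (u d false).
  rewrite -subr_eq0 !sum_phi; move: (fP (enum_rank d)).
  rewrite /A /c /r enum_rankK; under eq_bigr do rewrite mulrBl.
  by rewrite sumrB opprD addrACA.
exists phi; split=> [x y xy | [v | d]]; last 2 first.
- by rewrite /phi /phi0 mem_nth // L1.
- by rewrite /phi /a mem_nth // L3.
move: xy; rewrite -mem_edges => xyG; pose d : edge G := exist (fun A => A \in edges G) _ xyG.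
have xu t : u d t \in [set x; y].
  by rewrite -[[set x; y]]/(val d) rE !inE; case: t; rewrite eqxx ?orbT.
(* The ends named by [u] may be [x] and [y] in either order. *)
move: (xu true) (xu false) (u_neq d) (phi_edge d); rewrite !inE.
by do 2![case/orP=> /eqP->]; rewrite ?eqxx // => _ /eqP // + E; rewrite E.
Qed.
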